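(* Let $p$ be a prime, and let $n\in\mathbb N$ and $n^*=\{-n\}_{p-1}$. Then $$(-1)^nF_p(n,0)\equiv\bar S(n^*+\{n\}_p,\{n\}_p)\equiv\frac{B_{n^*}^{(m)}}{n^*!}\pmod p,$$ where $m$ is any nonnegative integer with $m+n\equiv0\pmod p$. Also, $$(-1)^nF_p(pn+p-1,r)\equiv\frac{B_{n^*}(-r)}{n^*!}\equiv-(p-1-n^* )!\,B_{n^*}(r+1)\pmod p$$ for all $r\in\mathbb Z$, and in particular $$\binom{2p-1}{p+r}+(-1)^p\binom{2p-1}r\equiv(-1)^rp^2B_{p-2}(-r)\pmod{p^3}$$ for every $r=0,\ldots,p-1$.
   Context: $\mathbb N=\{0,1,2,\ldots\}$. For $a\in\mathbb Z$ and a positive integer $m$, $\{a\}_m$ denotes the least nonnegative residue of $a$ modulo $m$. For a prime $p$, $n\in\mathbb N$ and $r\in\mathbb Z$, put $C_p(n,r)=\sum_{0\le k\le n,\ k\equiv r\,(\mathrm{mod}\ p)}\binom nk(-1)^k$. The Fleck quotient is $$F_p(n,r)=(-p)^{-\lfloor(n-1)/(p-1)\rfloor}C_p(n,r)+[\![n=0]\!],$$ where $[\![A]\!]$ is $1$ if the assertion $A$ holds and $0$ otherwise; it is an integer (Fleck). Let $(x)_0=1$ and $(x)_k=x(x-1)\cdots(x-k+1)$ for $k\ge1$. The Stirling numbers of the second kind $S(n,k)$ ($n,k\in\mathbb N$) are given by $x^n=\sum_{k\in\mathbb N}S(n,k)(x)_k$, and $\bar S(n,k)=\frac{k!}{n!}S(n,k)$.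 For $m\in\mathbb N$ the $m$-th order Bernoulli polynomials $B_n^{(m)}(t)$ are defined by $$\frac{x^me^{tx}}{(e^x-1)^m}=\sum_{n=0}^\infty B_n^{(m)}(t)\frac{x^n}{n!},$$ and $B_n^{(m)}=B_n^{(m)}(0)$; the usual Bernoulli polynomials are $B_n(t)=B_n^{(1)}(t)$. Congruences between rational numbers modulo a power $p^b$ are understood in the ring $\mathbb Z_p$ of $p$-adic integers, i.e. $x\equiv y\pmod{p^b}$ means $x-y\in p^b\mathbb Z_p$. *)

(* Defs.v *)
From HB Require Import structures.
From mathcomp Require Import all_boot all_order all_algebra.

Set Implicit Arguments.
Unset Strict Implicit.
Unset Printing Implicit Defensive.

Import Order.TTheory GRing.Theory Num.Theory.
Local Open Scope ring_scope.

(* {a}_m: [modz] by a positive modulus is the least nonnegative residue. *)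
Definition residue (a : int) (m : nat) : nat := `|(a %% m%:Z)%Z|%N.

(* Z_p meets Q exactly in the fractions whose reduced denominator is prime
   to p; [denq] is the (positive) denominator in lowest terms. *)
Definition padic_integer (p : nat) (x : rat) : bool := coprime p `|denq x|%N.

Definition eqmod_padic (p b : nat) (x y : rat) : Prop :=
  exists2 z : rat, padic_integer p z & x - y = p%:R ^+ b * z.

Definition fleck_sum (p n : nat) (r : int) : int :=
  \sum_(k < n.+1 | (k%:Z == r %[mod p%:Z])%Z) 'C(n, k)%:Z * (-1) ^+ k.

(* [divz] by the positive p - 1 is the floor, also for n = 0, where the
   exponent below is therefore 1. *)
Definition fleck_quotient (p n : nat) (r : int) : rat :=
  (- p%:R) ^ (- ((n%:Z - 1) %/ (p%:Z - 1))%Z) * (fleck_sum p n r)%:~R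
  + (n == 0%N)%:R.

Definition falling (k : nat) : {poly rat} := \prod_(i < k) ('X - i%:R%:P).

Lemma falling_mulX k : 'X * falling k = falling k.+1 + k%:R *: falling k.
Proof.
by rewrite /falling big_ord_recr /= -mul_polyC [in RHS]mulrC -mulrDl subrK.
Qed.

Lemma falling_expansion_exists (n : nat) :
  exists s : {poly rat}, 'X^n == \sum_(k < size s) s`_k *: falling k.
Proof.
suff [c cE] : exists c : nat -> rat, 'X^n = \sum_(k < n.+1) c k *: falling k.
  exists (\poly_(k < n.+1) c k); apply/eqP.
  rewrite (big_ord_widen n.+1 (fun k => (\poly_(j < n.+1) c j)`_k *: falling k))
          ?size_poly // cE [RHS]big_mkcond; apply: eq_bigr => k _.
  case: ltnP => [_|le_k]; first by rewrite coef_poly ltn_ord.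
  have := coef_poly n.+1 c k; rewrite ltn_ord nth_default // => c0.
  by rewrite -c0 scale0r.
elim: n => [|n [c cE]].
  by exists (fun=> 1); rewrite big_ord1 /falling big_ord0 scale1r expr0.
exists (fun k => (if k is j.+1 then c j else 0) + (k < n.+1)%N%:R * (k%:R * c k)).
rewrite exprS cE mulr_sumr.
under [RHS]eq_bigr do rewrite scalerDl.
rewrite big_split /= [X in _ = X + _]big_ord_recl scale0r add0r.
rewrite [X in _ = _ + X]big_ord_recr /= ltnn mul0r scale0r addr0 -big_split /=.
apply: eq_bigr => k _ /=.
by rewrite -scalerAr falling_mulX scalerDr scalerA ltn_ord mul1r [k%:R * _]mulrC.
Qed.

(* A {poly rat} serves here as a finitely supported sequence of coefficients,
   which makes the sequence (S(n, k))_k unique. *)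
Definition stirling2 (n k : nat) : rat := (xchoose (falling_expansion_exists n))`_k.

Lemma stirling2P (n N : nat) : (n < N)%N ->
  'X^n = \sum_(k < N) stirling2 n k *: falling k.
Proof.
move=> lt_nN; rewrite /stirling2; set s := xchoose _.
have /eqP sE : 'X^n == \sum_(k < size s) s`_k *: falling k.
  exact: xchooseP (falling_expansion_exists n).
have szf k : size (falling k) = k.+1.
  by rewrite /falling size_prod_XsubC /index_enum -enumT size_enum_ord.
have szs : (size s <= n.+1)%N.
  case E : (size s) => [//|m]; rewrite -(size_polyXn rat n) sE E big_ord_recr /=.
  have lc : s`_m != 0.
    by have := lead_coefE s; rewrite E /= => <-; rewrite lead_coef_eq0 -size_poly_gt0 E.
  rewrite addrC size_polyDl size_scale // szf // ltnS.
  apply: (leq_trans (size_sum _ _ _)); apply/bigmax_leqP => k _.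
  by apply: (leq_trans (size_scale_leq _ _)); rewrite szf.
rewrite [LHS]sE (big_ord_widen N (fun k => s`_k *: falling k) (leq_trans szs lt_nN)).
rewrite big_mkcond; apply: eq_bigr => k _.
by case: ltnP => // le_sk; rewrite nth_default ?scale0r.
Qed.

Definition stirling2_bar (n k : nat) : rat := k`!%:R / n`!%:R * stirling2 n k.

(* Formal power series over a ring, given by their coefficients. *)
Section Series.
Variable R : comUnitRingType.
Implicit Types a b c : nat -> R.

Definition ser1 : nat -> R := fun n => (n == 0%N)%:R.

Definition ser_mul a b : nat -> R := fun n => \sum_(i < n.+1) a i * b (n - i)%N.

Definition ser_pow a (m : nat) : nat -> R := iter m (ser_mul a) ser1.

(* [:: b_0; ...; b_n], where b is the inverse of a: the coefficients solve
   a_0 b_0 = 1 and a_0 b_n + ... + a_n b_0 = 0 for n > 0. *)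
Fixpoint ser_inv_seq a (n : nat) : seq R :=
  if n is n'.+1 then
    let s := ser_inv_seq a n' in
    rcons s (- (a 0%N)^-1 * \sum_(i < n) a (n - i)%N * s`_i)
  else [:: (a 0%N)^-1].

Definition ser_inv a : nat -> R := fun n => (ser_inv_seq a n)`_n.

(* a / x, for a series a without constant term *)
Definition ser_divX a : nat -> R := fun n => a n.+1.

(* e^(t x) *)
Definition ser_exp (t : R) : nat -> R := fun n => t ^+ n / n`!%:R.

Lemma ser_mulC a b : ser_mul a b =1 ser_mul b a.
Proof.
move=> n; rewrite /ser_mul (reindex_inj rev_ord_inj) /=; apply: eq_bigr => i _.
have le_in : (i <= n)%N by rewrite -ltnS.
by rewrite subSS subKn // mulrC.
Qed.

Lemma eq_ser_mul a a' b b' : a =1 a' -> b =1 b' -> ser_mul a b =1 ser_mul a' b'.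
Proof. by move=> ea eb n; apply: eq_bigr => i _; rewrite ea eb. Qed.

Lemma ser_mulA a b c : ser_mul a (ser_mul b c) =1 ser_mul (ser_mul a b) c.
Proof.
move=> n; pose T (u : nat -> R) : {poly R} := \poly_(i < n.+1) u i.
have TE u i : (i <= n)%N -> (T u)`_i = u i by rewrite coef_poly ltnS => ->.
have TM u v i : (i <= n)%N -> ser_mul u v i = (T u * T v)`_i.
  move=> le_in; rewrite coefM; apply: eq_bigr => j _.
  have le_ji : (j <= i)%N by rewrite -ltnS.
  by rewrite !TE // ?(leq_trans le_ji) // (leq_trans (leq_subr _ _)).
transitivity (T a * (T b * T c))`_n.
  rewrite coefM; apply: eq_bigr => j _.
  by rewrite TM ?leq_subr // TE // -ltnS.
rewrite mulrA coefM; apply: eq_bigr => j _.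
by rewrite -TM ?TE ?leq_subr // -ltnS.
Qed.

Lemma ser_mul1 a : ser_mul ser1 a =1 a.
Proof.
move=> n; rewrite /ser_mul big_ord_recl /ser1 eqxx mul1r subn0 big1 ?addr0 // => i _.
by rewrite lift0 mul0r.
Qed.

Lemma ser_mulV a : a 0%N \is a GRing.unit -> ser_mul a (ser_inv a) =1 ser1.
Proof.
move=> ua; have szs n : size (ser_inv_seq a n) = n.+1.
  by elim: n => //= n IHn; rewrite size_rcons IHn.
have nths n i : (i <= n)%N -> (ser_inv_seq a n)`_i = ser_inv a i.
  elim: n i => [|n IHn] i; first by rewrite leqn0 => /eqP ->.
  rewrite leq_eqVlt => /predU1P[-> //|lt_in] /=.
  by rewrite nth_rcons szs lt_in IHn.
move=> n; rewrite ser_mulC /ser_mul big_ord_recr /= subnn.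
case: n => [|n]; first by rewrite big_ord0 add0r /ser_inv /= mulVr.
rewrite {2}/ser_inv /= nth_rcons szs ltnn eqxx mulNr mulNr mulrAC mulVr // mul1r.
rewrite -sumrB big1 // => i _.
have le_in : (i <= n)%N by rewrite -ltnS.
by rewrite nths // mulrC subrr.
Qed.

End Series.

(* The generating function x^m e^(tx) / (e^x - 1)^m, with t the indeterminate
   of {poly rat}; x^m and (e^x - 1)^m have a zero constant term, so their
   quotient is read as the inverse of ((e^x - 1) / x)^m. *)
Definition expm1 : nat -> {poly rat} := fun n => ser_exp 1 n - ser1 _ n.

Definition bernoulli_series (m : nat) : nat -> {poly rat} :=
  ser_mul (ser_inv (ser_pow (ser_divX expm1) m)) (ser_exp 'X).

Definition bernoulli_poly (m n : nat) : {poly rat} :=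
  n`!%:R * bernoulli_series m n.

Definition bernoulli_number (m n : nat) : rat := (bernoulli_poly m n).[0].

Lemma bernoulli_polyP (m : nat) :
  ser_mul (ser_pow expm1 m) (fun n => bernoulli_poly m n / n`!%:R)
  =1 ser_mul (fun n => (n == m)%:R) (ser_exp 'X).
Proof.
pose X1 : nat -> {poly rat} := fun n => (n == 1)%:R.
have XM u n : ser_mul X1 u n = if n is n'.+1 then u n' else 0.
  case: n => [|n]; first by rewrite /ser_mul big_ord1 mul0r.
  rewrite /ser_mul 2!big_ord_recl mul0r add0r mul1r subSS subn0 big1 ?addr0 // => i _.
  by rewrite /X1 !lift0 mul0r.
have expE : expm1 =1 ser_mul X1 (ser_divX expm1).
  move=> n; rewrite XM; case: n => // [].
  by rewrite /expm1 /ser_exp /ser1 expr0 fact0 divr1 subrr.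
have powM (u v : nat -> {poly rat}) k :
    ser_pow (ser_mul u v) k =1 ser_mul (ser_pow u k) (ser_pow v k).
  elim: k => [|k IHk] n; first by rewrite /= ser_mul1.
  rewrite /= (eq_ser_mul (frefl _) IHk) -ser_mulA.
  rewrite (eq_ser_mul (frefl u) (ser_mulA _ _ _)).
  rewrite (eq_ser_mul (frefl u) (eq_ser_mul (ser_mulC _ _) (frefl _))).
  by rewrite -(eq_ser_mul (frefl u) (ser_mulA _ _ _)) ser_mulA.
have eq_pow u v k : u =1 v -> @ser_pow {poly rat} u k =1 ser_pow v k.
  by move=> uv; elim: k => //= k IHk; apply: eq_ser_mul.
have powX k : ser_pow X1 k =1 fun n => (n == k)%:R.
  by elim: k => [|k IHk] n //=; rewrite XM; case: n => // n; rewrite IHk.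
have bE : (fun n => bernoulli_poly m n / n`!%:R) =1 bernoulli_series m.
  move=> n; rewrite /bernoulli_poly mulrAC divrr ?mul1r //.
  by rewrite -polyC_natr rmorph_unit // unitfE pnatr_eq0 -lt0n fact_gt0.
set g := ser_divX expm1 in expE.
have ug : (ser_pow g m) 0%N \is a GRing.unit.
  suff -> : (ser_pow g m) 0%N = 1 by apply: unitr1.
  elim: (m) => // k IHk; rewrite /= /ser_mul big_ord1 subnn IHk mulr1.
  by rewrite /g /ser_divX /expm1 /ser_exp /ser1 subr0 expr1 divr1.
move=> n; rewrite (eq_ser_mul (eq_pow _ _ _ expE) bE) /bernoulli_series -/g.
rewrite (eq_ser_mul (powM _ _ _) (frefl _)) -ser_mulA.
apply: eq_ser_mul => [|{}n]; first exact: powX.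
by rewrite ser_mulA (eq_ser_mul (ser_mulV ug) (frefl _)) ser_mul1.
Qed.

(* Main.v *)
Require Import Defs.
From mathcomp Require Import all_boot all_order all_algebra.
From mathcomp Require Import ring zify.

Import Order.TTheory GRing.Theory Num.Theory.
Local Open Scope ring_scope.

(* Reduce everything to F_p. In F_p[t]/(t^p) the truncated exponential x = e^t
   satisfies x^p = 1, so the group ring Z[X]/(X^p - 1) maps there by X |-> x, and
   1 - X |-> - t g with g = (e^t - 1)/t. From (1 - X)^p = 1 - X^p - p (1 - X) U,
   the Fleck quotient for n = (p - 1) q + s with 1 <= s <= p - 1 is the sum of the
   coefficients of U^q (1 - X)^s in the class of r. Differentiating shows that
   (1 - X) U maps to - t, that is U |-> 1/g modulo t^(p-1); and, on multiples of t,
   the class sum is f |-> [t^(p-1)] e^(-rt) f. Hence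
     (-1)^n F_p(n, r) = [t^N] e^(-rt) g^n  in F_p,  N = p - 1 - s = {-n}_(p-1),
   and g^p = 1 modulo t^(p-1) makes the exponent matter only modulo p. Both the
   Stirling and the Bernoulli side are such coefficients over Q, reduced mod p. *)

(** * Congruence of polynomials modulo a power of the indeterminate *)

Definition eqX (R : nzRingType) (N : nat) (P Q : {poly R}) :=
  forall i, (i < N)%N -> P`_i = Q`_i.

Section CongruenceModX.
Variable R : comNzRingType.
Implicit Types P Q : {poly R}.

Lemma eqX_trans N P Q S : eqX R N P Q -> eqX R N Q S -> eqX R N P S.
Proof. by move=> PQ QS i iN; rewrite PQ ?QS. Qed.

Lemma eqX_sym N P Q : eqX R N P Q -> eqX R N Q P.
Proof. by move=> PQ i iN; rewrite PQ. Qed.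

Lemma eqX_refl N P : eqX R N P P. Proof. by []. Qed.

Lemma eqX_le M N P Q : (M <= N)%N -> eqX R N P Q -> eqX R M P Q.
Proof. by move=> le_MN PQ i iM; rewrite PQ // (leq_trans iM). Qed.

Lemma eqX_mul N P P' Q Q' :
  eqX R N P P' -> eqX R N Q Q' -> eqX R N (P * Q) (P' * Q').
Proof.
move=> PP QQ i iN; rewrite !coefM; apply: eq_bigr => j _.
have ji : (j <= i)%N by rewrite -ltnS.
by rewrite PP ?QQ // ?(leq_ltn_trans (leq_subr _ _)) // (leq_ltn_trans ji).
Qed.

Lemma eqX_exp N P P' k : eqX R N P P' -> eqX R N (P ^+ k) (P' ^+ k).
Proof. by move=> PP; elim: k => // k IHk; rewrite !exprS; apply: eqX_mul. Qed.

Lemma eqX_mulX N P Q : eqX R N.+1 ('X * P) ('X * Q) -> eqX R N P Q.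
Proof. by move=> PQ i iN; have := PQ i.+1 iN; rewrite !coefXM. Qed.

Lemma coef0_exp (P : {poly R}) k : (P ^+ k)`_0 = P`_0 ^+ k.
Proof. by rewrite -!horner_coef0 horner_exp. Qed.

End CongruenceModX.
Arguments eqX {R}.

(** * The truncated exponential *)

Section TruncatedExp.
Variables (F : fieldType) (N : nat).
Hypothesis factN : forall i, (i < N)%N -> i`!%:R != 0 :> F.

Definition expX (a : F) : {poly F} := \poly_(i < N) (a ^+ i / i`!%:R).

(** The series g = (e^t - 1)/t; dividing by t costs one coefficient, hence the length [N.-1]. *)
Definition expm1X : {poly F} := \poly_(i < N.-1) (i.+1`!%:R)^-1.

Lemma expXD a b : eqX N (expX a * expX b) (expX (a + b)).
Proof.
move=> n nN; rewrite coefM coef_poly nN exprDn mulr_suml.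
rewrite (reindex_inj rev_ord_inj) /=; apply: eq_bigr => i _.
have le_in : (i <= n)%N by rewrite -ltnS.
rewrite subSS subKn // !coef_poly (leq_ltn_trans (leq_subr _ _)) // (leq_ltn_trans le_in) //.
have := bin_fact le_in => /(congr1 (fun k => k%:R : F)); rewrite !natrM => E.
have nz := factN _ nN.
have nzi := factN _ (leq_ltn_trans le_in nN).
have nzni := factN _ (leq_ltn_trans (leq_subr i n) nN).
rewrite -mulr_natr; apply: (mulIf nz); rewrite divfK // -{1}E.
by field; rewrite nzi nzni.
Qed.

Lemma expX0 : (0 < N)%N -> expX 0 = 1.
Proof.
move=> N0; apply/polyP => i; rewrite coef_poly coef1; case: i => [|i].
  by rewrite N0 expr0 divr1.
by rewrite expr0n mul0r if_same.
Qed.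

Lemma expX_exp a k : (0 < N)%N -> eqX N (expX a ^+ k) (expX (k%:R * a)).
Proof.
move=> N0; elim: k => [|k IHk]; first by rewrite mul0r expX0.
rewrite exprS; apply: eqX_trans (eqX_mul _ _ _ _ _ _ (eqX_refl _ _ _) IHk) _.
by rewrite mulrS mulrDl mul1r; apply: expXD.
Qed.

Lemma expX1E : (0 < N)%N -> expX 1 = 1 + 'X * expm1X.
Proof.
move=> N0; apply/polyP => i; rewrite coefD coef1 coefXM !coef_poly expr1n mul1r.
case: i => [|i] /=; first by rewrite N0 invr1 addr0.
by rewrite add0r ltn_predRL.
Qed.

Lemma deriv_expX1 : eqX N.-1 (expX 1)^`() (expX 1).
Proof.
move=> i; rewrite ltn_predRL => iN; rewrite coef_deriv !coef_poly iN (ltnW iN) !expr1n !mul1r.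
have := factN _ iN; rewrite factS natrM mulf_eq0 negb_or => /andP[nz1 nz2].
by rewrite -[LHS]mulr_natr invfM mulrAC mulVf // mul1r.
Qed.

End TruncatedExp.
Arguments expX {F}. Arguments expm1X {F}.

(** * Reduction of p-integral rationals to F_p *)

Section ReductionModp.
Variable p : nat.
Hypothesis p_pr : prime p.
Let pF := pchar_Fp p_pr.

(* x = a / b with b prime to p, and c = a / b in F_p; the equations are cleared of
   denominators so that no condition on division by zero arises. *)
Definition red (x : rat) (c : 'F_p) : Prop :=
  exists a b : int, [/\ b%:~R != 0 :> 'F_p, x * b%:~R = a%:~R & c * b%:~R = a%:~R].

Lemma red_int (k : int) : red k%:~R k%:~R.
Proof. by exists k, 1; split; rewrite ?oner_eq0 ?mulr1. Qed.

Lemma red_nat (k : nat) : red k%:R k%:R.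
Proof. exact: red_int k. Qed.

Lemma redD x y c d : red x c -> red y d -> red (x + y) (c + d).
Proof.
case=> a [b [nz xa ca]] [a' [b' [nz' ya da]]]; exists (a * b' + a' * b), (b * b').
split; first by rewrite intrM mulf_neq0.
  by rewrite intrM intrD !intrM -xa -ya; ring.
by rewrite intrM intrD !intrM -ca -da; ring.
Qed.

Lemma redM x y c d : red x c -> red y d -> red (x * y) (c * d).
Proof.
case=> a [b [nz xa ca]] [a' [b' [nz' ya da]]]; exists (a * a'), (b * b').
split; first by rewrite intrM mulf_neq0.
  by rewrite !intrM -xa -ya; ring.
by rewrite !intrM -ca -da; ring.
Qed.

Lemma redN x c : red x c -> red (- x) (- c).
Proof. by rewrite -mulN1r -[- c]mulN1r; apply: redM; apply: (red_int (-1)). Qed.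

Lemma redX x c k : red x c -> red (x ^+ k) (c ^+ k).
Proof.
move=> xc; elim: k => [|k IHk]; first exact: (red_nat 1).
by rewrite !exprS; apply: redM.
Qed.

Lemma red_sum (I : Type) (s : seq I) (P : pred I) (f : I -> rat) (h : I -> 'F_p) :
  (forall i, P i -> red (f i) (h i)) ->
  red (\sum_(i <- s | P i) f i) (\sum_(i <- s | P i) h i).
Proof.
move=> fh; apply: (big_ind2 red) => //; first exact: (red_nat 0).
by move=> *; apply: redD.
Qed.

Lemma red_invn (k : nat) : k%:R != 0 :> 'F_p -> red k%:R^-1 k%:R^-1.
Proof.
move=> nz; exists 1, k; split; rewrite ?mulVf //.
by apply: contraNneq nz => /eqP; rewrite pnatr_eq0 => /eqP->.
Qed.

Lemma fact_Fp_neq0 i : (i < p)%N -> i`!%:R != 0 :> 'F_p.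
Proof.
elim: i => [|i IHi] ip; first by rewrite oner_eq0.
rewrite factS natrM mulf_neq0 ?IHi 1?ltnW //.
by rewrite -(dvdn_pcharf pF) gtnNdvd.
Qed.

(** The difference is a/b with b prime to p and, its residue being 0, with a = p a'. The reduced
    denominator of a'/b divides b, hence is prime to p. *)
Lemma red_eqmod x y c : red x c -> red y c -> eqmod_padic p 1 x y.
Proof.
move=> xc yc; have [a [b [nz xa]]] := redD _ _ _ _ xc (redN _ _ yc).
rewrite subrr mul0r => /esym/eqP; rewrite -(dvdz_pcharf pF) => /dvdzP[a' aE].
have p0 : p%:R != 0 :> rat by rewrite pnatr_eq0 -lt0n prime_gt0.
have b0 : b%:~R != 0 :> rat.
  by apply: contraNneq nz => /eqP; rewrite intr_eq0 => /eqP->.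
exists (a'%:~R / b%:~R); last first.
  by apply: (mulIf b0); rewrite xa aE intrM -mulrA divfK // mulrC expr1.
rewrite /padic_integer; set z := _ / _.
have cpb : coprime p `|b|%N.
  by rewrite prime_coprime //; move: nz; rewrite -(dvdz_pcharf pF) dvdzE.
apply: coprime_dvdr cpb.
have zE : z * b%:~R = a'%:~R by rewrite /z divfK.
have : (denq z %| numq z * b)%Z.
  apply/dvdzP; exists a'; apply: (@intr_inj rat).
  by rewrite !intrM -zE numqE mulrAC.
by rewrite Gauss_dvdzr // coprimezE coprime_sym coprime_num_den.
Qed.

(* Only the coefficients below p - 1 matter: those of g = (e^t - 1)/t beyond have
   denominators divisible by p. *)
Definition redpoly (P : {poly rat}) (Q : {poly 'F_p}) :=
  forall i, (i < p.-1)%N -> red P`_i Q`_i.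

Lemma redpolyM P P' Q Q' : redpoly P Q -> redpoly P' Q' -> redpoly (P * P') (Q * Q').
Proof.
move=> PQ PQ' i ip; rewrite !coefM; apply: red_sum => j _; apply: redM.
  by apply: PQ; rewrite (leq_ltn_trans _ ip) // -ltnS.
by apply: PQ'; rewrite (leq_ltn_trans _ ip) // leq_subr.
Qed.

Lemma redpolyX P Q k : redpoly P Q -> redpoly (P ^+ k) (Q ^+ k).
Proof.
move=> PQ; elim: k => [|k IHk]; last by rewrite !exprS; apply: redpolyM.
by move=> i _; rewrite !coef1; apply: red_nat.
Qed.

Lemma redpoly_expm1X N : (p <= N)%N -> redpoly (expm1X N) (expm1X p).
Proof.
move=> pN i ip; have Si : (i.+1 < p)%N by rewrite -ltn_predRL.
rewrite !coef_poly ip ltn_predRL (leq_trans Si) //.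
by apply: red_invn; apply: fact_Fp_neq0.
Qed.

End ReductionModp.

(** * Fleck sums in the group ring Z[X]/(X^p - 1) *)

Section FleckSum.
Variable p : nat.
Hypothesis p_pr : prime p.
Let pF := pchar_Fp p_pr.
Let p_gt0 : (0 < p)%N := prime_gt0 p_pr.

Local Notation modp := (map_poly (intr : int -> 'F_p)).

(** By Frobenius, 1 - X^p - (1 - X)^p is divisible by p; the quotient vanishes at 1, so 1 - X splits
    off as well. *)
Lemma exists_fleck_factor :
  exists U : {poly int}, (1 - 'X) ^+ p = 1 - 'X^p - p%:R *: ((1 - 'X) * U).
Proof.
pose W : {poly int} := 1 - 'X^p - (1 - 'X) ^+ p.
have pP : p \in [pchar {poly 'F_p}] by rewrite pchar_poly.
have W0 : modp W = 0.
  rewrite /W !rmorphB !rmorphXn rmorphB rmorph1 /= map_polyX.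
  rewrite -[X in _ - X](pFrobenius_autE pP) pFrobenius_autB_comm; last exact: mulrC.
  by rewrite pFrobenius_aut1 pFrobenius_autE subrr.
pose V : {poly int} := \poly_(i < size W) (W`_i %/ p%:Z)%Z.
have WV : W = p%:R *: V.
  apply/polyP => i; rewrite coefZ coef_poly.
  case: ltnP => [_|?]; last by rewrite nth_default ?mulr0.
  rewrite mulrC natz divzK // (dvdz_pcharf pF).
  by have /polyP/(_ i) := W0; rewrite coef_map coef0 /= => ->.
have V1 : root V 1.
  have /(congr1 (horner_eval 1)) := WV.
  rewrite /horner_eval hornerZ /W !hornerE subrr expr1n subrr expr0n.
  rewrite gtn_eqF // subr0 => /esym/eqP; rewrite mulf_eq0 => /orP[|//].
  by rewrite pnatr_eq0 gtn_eqF.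
have /factor_theorem[S SE] := V1.
exists (- S); rewrite mulrN -mulNr opprB [('X - 1) * S]mulrC -SE -WV /W; ring.
Qed.

(** The coefficient at the class of r of the image of Q in Z[X]/(X^p - 1). *)
Definition class_sum (r : int) (Q : {poly int}) : int :=
  \sum_(k < size Q | (k%:Z == r %[mod p%:Z])%Z) Q`_k.

Lemma class_sum_widen r (Q : {poly int}) N : (size Q <= N)%N ->
  class_sum r Q = \sum_(k < N | (k%:Z == r %[mod p%:Z])%Z) Q`_k.
Proof.
move=> QN; rewrite /class_sum.
rewrite (big_ord_widen_cond N (fun k : nat => (k%:Z == r %[mod p%:Z])%Z)
           (fun k => Q`_k) QN).
rewrite [LHS]big_mkcond [RHS]big_mkcond; apply: eq_bigr => k _ /=.
case: (ltnP k (size Q)) => // [|le_k]; first by rewrite andbT.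
by rewrite nth_default // andbF if_same.
Qed.

Lemma class_sumB r P Q : class_sum r (P - Q) = class_sum r P - class_sum r Q.
Proof.
pose N := maxn (size P) (size Q).
have sN : (size (P - Q)%R <= N)%N by rewrite (leq_trans (size_polyD _ _)) // size_polyN.
rewrite (class_sum_widen r _ _ sN) (class_sum_widen r P N) ?leq_maxl //.
rewrite (class_sum_widen r Q N) ?leq_maxr // -sumrB.
by apply: eq_bigr => k _; rewrite coefB.
Qed.

Lemma class_sumZ r a Q : class_sum r (a *: Q) = a * class_sum r Q.
Proof.
rewrite (class_sum_widen r (a *: Q) (size Q)) ?size_scale_leq //.
by rewrite mulr_sumr; apply: eq_bigr => k _; rewrite coefZ.
Qed.

Lemma class_sum_Xp r Q : class_sum r ('X^p * Q) = class_sum r Q.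
Proof.
rewrite (class_sum_widen r _ (p + size Q)); last first.
  by rewrite (leq_trans (size_polyMleq _ _)) // size_polyXn.
rewrite big_split_ord /= big1 => [|i _]; last by rewrite coefXnM ltn_ord.
rewrite add0r; apply: eq_big => [i|i _] /=; last by rewrite coefXnM ltnNge leq_addr addKn.
by rewrite PoszD modzDl.
Qed.

Lemma fleck_sumE n r : fleck_sum p n r = class_sum r ((1 - 'X) ^+ n).
Proof.
have -> : (1 - 'X) ^+ n = \poly_(k < n.+1) ('C(n, k)%:Z * (-1) ^+ k).
  rewrite exprDn poly_def; apply: eq_bigr => k _.
  rewrite expr1n mul1r [in LHS]exprNn -scaler_nat -scalerA natz.
  by rewrite -(mul_polyC ((-1) ^+ k)) polyC_exp polyCN.
rewrite (class_sum_widen r _ n.+1) ?size_poly //.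
by apply: eq_bigr => k _; rewrite coef_poly ltn_ord.
Qed.

(** Class sums kill multiples of 1 - X^p, so (1 - X)^p may be traded for - p (1 - X) U. Each trade
    lowers the exponent of 1 - X by p - 1 and yields a factor - p. *)
Lemma class_sum_expB (U : {poly int}) r q s Q : (0 < s)%N ->
  (1 - 'X) ^+ p = 1 - 'X^p - p%:R *: ((1 - 'X) * U) ->
  class_sum r ((1 - 'X) ^+ (p.-1 * q + s) * Q)
  = (- p%:R) ^+ q * class_sum r (U ^+ q * (1 - 'X) ^+ s * Q).
Proof.
move=> s0 UE; elim: q Q => [|q IHq] Q; first by rewrite muln0 !mul1r.
(* As s > 0, the exponent is at least p and a full p-th power can be split off. *)
have -> : (p.-1 * q.+1 + s = (p.-1 * q + s).-1 + p)%N.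
  by move: (s0) (p_gt0); rewrite mulnSr; move: (p.-1 * q)%N => m; lia.
rewrite exprD UE mulrBr mulrBl mulrBr mulr1 mulrBl class_sumB.
rewrite [X in X - _]class_sumB.
rewrite [_ * 'X^p]mulrC -['X^p * _ * Q]mulrA class_sum_Xp subrr sub0r.
rewrite -scalerAr -scalerAl class_sumZ mulrA -exprSr prednK ?addn_gt0 ?s0 ?orbT //.
rewrite -[_ * U * Q]mulrA IHq exprS -mulNr -[RHS]mulrA; congr (_ * (_ * class_sum r _)).
by rewrite [U ^+ q.+1]exprSr; ring.
Qed.

End FleckSum.

(** * The Fleck quotient as a coefficient over F_p *)

Section FleckModp.
Variable p : nat.
Hypothesis p_pr : prime p.
Let pF := pchar_Fp p_pr.
Let p_gt0 : (0 < p)%N := prime_gt0 p_pr.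
Let factN := fact_Fp_neq0 p p_pr.

Local Notation modp := (map_poly (intr : int -> 'F_p)).
Local Notation x := (expX p (1 : 'F_p)).
Local Notation g := (expm1X p : {poly 'F_p}).

Lemma expf_p1 (a : 'F_p) : a != 0 -> a ^+ p.-1 = 1.
Proof.
move=> a0; apply: (mulfI a0); rewrite mulr1 -exprS prednK //.
by rewrite -[a]natr_Zp -(pFrobenius_autE pF) pFrobenius_aut_nat.
Qed.

Lemma fact_Fp_p1 : (p.-1)`!%:R = -1 :> 'F_p.
Proof.
apply/eqP; rewrite -subr_eq0 opprK natr1 -(dvdn_pcharf pF).
by rewrite -Wilson ?prime_gt1.
Qed.

(** Induction from Wilson's theorem: passing from k to k + 1 moves the factor p - 1 - k, which is -
    (k + 1) in F_p, to the other factorial. *)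
Lemma fact_Fp_compl k : (k < p)%N -> k`!%:R * (p.-1 - k)`!%:R = (-1) ^+ k.+1 :> 'F_p.
Proof.
elim: k => [|k IHk] kp; first by rewrite mul1r subn0 fact_Fp_p1 expr1.
have := IHk (ltnW kp); have -> : (p.-1 - k = (p.-1 - k.+1).+1)%N by lia.
rewrite factS natrM => E; rewrite factS natrM exprS -E.
have -> : (p.-1 - k.+1).+1%:R = - k.+1%:R :> 'F_p; last by ring.
apply/eqP; rewrite -subr_eq0 opprK -natrD -(dvdn_pcharf pF).
by have -> : ((p.-1 - k.+1).+1 + k.+1 = p)%N by lia.
Qed.

Lemma sign_Fp_p : (-1) ^+ p = -1 :> 'F_p.
Proof. by rewrite -(pFrobenius_autE pF) pFrobenius_autN pFrobenius_aut1. Qed.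

(** Writing g = 1 + X h, Frobenius gives g^p = 1 + X^p h^p. *)
Lemma expm1X_expp : eqX p.-1 (g ^+ p) 1.
Proof.
suff: eqX p (g ^+ p) 1 by apply: eqX_le; apply: leq_pred.
have pP : p \in [pchar {poly 'F_p}] by rewrite pchar_poly.
have [h gE] : exists h, g = 1 + 'X * h.
  have : root (g - 1) 0.
    rewrite /root hornerD hornerN hornerC horner_coef0 coef_poly.
    by rewrite ltn_predRL prime_gt1 // invr1 subrr.
  case/factor_theorem => h; rewrite subr0 => E; exists h.
  by rewrite mulrC -E addrC subrK.
rewrite gE -(pFrobenius_autE pP) pFrobenius_autD_comm; last exact: mulrC.
rewrite pFrobenius_aut1 pFrobenius_autE exprMn => i ip.
by rewrite coefD coefXnM ip addr0.
Qed.

Lemma expm1X_congr m n : (m = n %[mod p])%N -> eqX p.-1 (g ^+ m) (g ^+ n).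
Proof.
suff H k : eqX p.-1 (g ^+ k) (g ^+ (k %% p)).
  by move=> mn; apply: eqX_trans (H m) _; rewrite mn; apply: eqX_sym.
rewrite {1}(divn_eq k p) exprD mulnC exprM -[X in eqX _ _ X]mul1r.
apply: eqX_mul => //; rewrite -[X in eqX _ _ X](expr1n _ (k %/ p)).
by apply: eqX_exp; apply: expm1X_expp.
Qed.

(* For a monomial X^k the right-hand side is 1 - (k - r)^(p-1), as x^k = e^(kt)
   and (p - 1)! = -1; this is the indicator of k = r mod p by Fermat. *)
Lemma class_sum_Fp r (Q : {poly int}) :
  (class_sum p r Q)%:~R
  = (modp Q \Po x)`_0 + (expX p (- r%:~R) * (modp Q \Po x))`_p.-1.
Proof.
have QE : modp Q \Po x = \sum_(k < size Q) (Q`_k)%:~R *: x ^+ k.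
  rewrite -{1}[Q]coefK poly_def rmorph_sum /= rmorph_sum /=; apply: eq_bigr => k _.
  by rewrite map_polyZ comp_polyZ rmorphXn /= map_polyX comp_Xn_poly.
rewrite QE mulr_sumr !coef_sum -big_split /= /class_sum big_mkcond rmorph_sum.
apply: eq_bigr => k _; rewrite -scalerAr !coefZ -mulrDr.
have -> : (x ^+ k)`_0 = 1.
  by rewrite coef0_exp coef_poly p_gt0 expr0 invr1 mulr1 expr1n.
have p1p : (p.-1 < p)%N by rewrite prednK.
have E : eqX p (expX p (- r%:~R) * x ^+ k) (expX p (k%:R - r%:~R)).
  apply: eqX_trans (eqX_mul _ _ _ _ _ _ (eqX_refl _ _ _) (expX_exp _ _ factN _ _ p_gt0)) _.
  by rewrite mulr1 [k%:R - _]addrC; apply: expXD.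
rewrite E // coef_poly p1p fact_Fp_p1 invrN1 mulrN1.
have -> : k%:R - r%:~R = (k%:Z - r)%:~R :> 'F_p by rewrite rmorphB.
rewrite eqz_mod_dvd (dvdz_pcharf pF); case: eqP => [->|/eqP nz].
  by rewrite expr0n -subn1 subn_eq0 leqNgt prime_gt1 //= subr0 mulr1.
by rewrite expf_p1 // subrr mulr0.
Qed.

(* The derivative of V(x), V = (1 - X) U, is ((1 - x)^(p-1) - x^(p-1)) x' = -1
   modulo t^(p-1), since x' = x there and x^p = 1. *)
Lemma expm1X_fleck_factor (U : {poly int}) :
  (1 - 'X) ^+ p = 1 - 'X^p - p%:R *: ((1 - 'X) * U) ->
  eqX p.-1 (g * (modp U \Po x)) 1.
Proof.
move=> UE; pose V := (1 - 'X) * U.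
have dV : V^`() = (1 - 'X) ^+ p.-1 - 'X^(p.-1).
  have /(congr1 (@deriv _)) := UE.
  rewrite !derivB derivZ derivXn deriv_exp derivB derivX derivC -/V.
  rewrite !sub0r mulN1r mulNrn => /eqP.
  rewrite -subr_eq0 => /eqP E; apply/eqP; rewrite -subr_eq0.
  have p0 : p%:R != 0 :> int by rewrite pnatr_eq0 -lt0n.
  have : p%:R *: (V^`() - ((1 - 'X) ^+ p.-1 - 'X^(p.-1))) == 0.
    rewrite -E scalerBr scalerBr !scaler_nat; apply/eqP; ring.
  by rewrite -mul_polyC mulf_eq0 polyC_eq0 (negPf p0).
have xE : x = 1 + 'X * g by apply: expX1E.
have V_x : modp V \Po x = - 'X * (g * (modp U \Po x)).
  rewrite /V rmorphM rmorphB rmorph1 /= map_polyX rmorphM rmorphB /= comp_polyX.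
  by rewrite rmorph1 xE; ring.
have dV_x : eqX p.-1 (modp V \Po x)^`() (-1).
  rewrite deriv_comp deriv_map dV.
  apply: (@eqX_trans _ _ _ (((- ('X * g)) ^+ p.-1 - x ^+ p.-1) * x)).
    rewrite !rmorphB !rmorphXn !rmorphB !rmorph1 /= map_polyX comp_polyX.
    have -> : 1 - x = - ('X * g) by rewrite xE; ring.
    by apply: eqX_mul => //; apply: deriv_expX1.
  (* The power of X g is a multiple of X^(p-1) and drops out; x^p = e^(pt) = 1 leaves -1. *)
  rewrite mulrBl -exprSr prednK // exprNn exprMn => i ip.
  rewrite coefB coefN -mulrA -mulrA [_ * ('X^_ * _)]mulrCA coefXnM ip sub0r.
  rewrite (expX_exp _ _ factN _ _ p_gt0) ?(leq_trans ip) ?leq_pred //.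
  by rewrite mulr1 pchar_Fp_0 // expX0.
(* The j-th coefficient of the derivative is - (j + 1) times that of g U(x), and j + 1 is invertible
   in F_p. *)
move=> j jp; have Sj : (j.+1 < p)%N by rewrite -ltn_predRL.
have := dV_x _ jp; rewrite V_x coef_deriv mulNr coefN coefXM /= coefN coef1.
rewrite mulNrn => /oppr_inj E.
have nz : j.+1%:R != 0 :> 'F_p by rewrite -(dvdn_pcharf pF) gtnNdvd.
apply: (mulIf nz); rewrite [LHS]mulr_natr E; case: (j) => [|i]; first by rewrite mulr1.
by rewrite mul0r.
Qed.

Lemma residueN n s q : n = (p.-1 * q + s)%N -> (0 < s <= p.-1)%N ->
  residue (- n%:Z) p.-1 = (p.-1 - s)%N.
Proof.
move=> -> /andP[s0 sp]; rewrite /residue.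
have -> : - (p.-1 * q + s)%N%:Z = (- q.+1%:Z) * p.-1%:Z + (p.-1 - s)%N%:Z by lia.
by rewrite modzMDl modz_small //; lia.
Qed.

(** The integer k is the class sum of U^q (1 - X)^s, so the first conclusion contains Fleck's
    divisibility. *)
Lemma fleck_quotient_Fp (n : nat) (r : int) : (0 < n)%N ->
  exists2 k : int, fleck_quotient p n r = k%:~R
    & (-1) ^+ n * k%:~R = (expX p (- r%:~R) * g ^+ n)`_(residue (- n%:Z) p.-1) :> 'F_p.
Proof.
move=> n0; have [U UE] := exists_fleck_factor p p_pr.
have p1 := prime_gt1 p_pr.
(* Dividing n - 1 instead of n puts s in 1..p-1 and makes q the exponent in the Fleck quotient. *)
pose q := (n.-1 %/ p.-1)%N; pose s := (n.-1 %% p.-1).+1.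
have nE : n = (p.-1 * q + s)%N.
  by rewrite /s addnS mulnC -divn_eq prednK.
have sp : (0 < s <= p.-1)%N by rewrite /s ltn_mod; lia.
exists (class_sum p r (U ^+ q * (1 - 'X) ^+ s)).
  rewrite /fleck_quotient gtn_eqF // addr0.
  have -> : (n%:Z - 1 = n.-1%:Z) by lia.
  have -> : (p%:Z - 1 = p.-1%:Z) by lia.
  rewrite divz_nat -/q fleck_sumE {1}nE -[_ ^+ (_ + s)]mulr1.
  rewrite (class_sum_expB p p_pr U) // ?mulr1.
  rewrite rmorphM rmorphXn rmorphN /= mulrA -exprnN rmorph_nat mulVf ?mul1r //.
  by rewrite expf_neq0 // oppr_eq0 pnatr_eq0; lia.
rewrite class_sum_Fp (residueN n s q) //.
have -> : modp (U ^+ q * (1 - 'X) ^+ s) \Po x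
    = 'X^s * ((- 1) ^+ s *: (g ^+ s * (modp U \Po x) ^+ q)).
  rewrite rmorphM !rmorphXn rmorphB rmorph1 /= map_polyX.
  rewrite rmorphM !rmorphXn rmorphB rmorph1 /= comp_polyX.
  rewrite {2}expX1E // opprD addrA subrr sub0r -scaleN1r exprZn exprMn -!scalerAr.
  by congr (_ *: _); ring.
(* Because of the factor X^s with s > 0 the constant term vanishes, and the coefficient at p - 1
   becomes the one at p - 1 - s. *)
rewrite coefXnM; case/andP: (sp) => -> s_le; rewrite add0r mulrCA coefXnM ltnNge s_le /=.
rewrite -scalerAr coefZ mulrA.
(* Here (-1)^((p-1) q) = 1 by Fermat, which covers p = 2 too. *)
have -> : (-1) ^+ n * (-1) ^+ s = 1 :> 'F_p.
  rewrite nE exprD exprM expf_p1 ?oppr_eq0 ?oner_eq0 // expr1n mul1r.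
  by rewrite -exprMn mulrNN mulr1 expr1n.
rewrite mul1r; apply: (eqX_mul _ p.-1); rewrite ?ltn_subrL; [by []| |lia].
rewrite nE addnC exprD exprM; apply: eqX_mul => //; apply: eqX_exp.
(* It remains that u = g^(p-1) modulo X^(p-1): u = g^p u = g^(p-1) (g u). *)
set u := modp U \Po x.
have gu : eqX p.-1 (g * u) 1 by apply: expm1X_fleck_factor.
rewrite -[u]mul1r.
apply: eqX_trans (eqX_mul _ _ _ _ _ _ (eqX_sym _ _ _ _ expm1X_expp) (eqX_refl _ _ u)) _.
have -> : g ^+ p = g ^+ p.-1 * g by rewrite -exprSr prednK.
rewrite -mulrA -[X in eqX _ _ X]mulr1.
exact: eqX_mul.
Qed.

End FleckModp.

(** * Stirling numbers as coefficients of powers of e^t - 1 *)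

Lemma horner_falling_nat (j k : nat) : (falling k).[j%:R] = (j ^_ k)%:R.
Proof.
elim: k => [|k IHk]; first by rewrite /falling big_ord0 hornerC.
rewrite /falling big_ord_recr -/(falling k) /= hornerM IHk !hornerE ffactnSr natrM.
case: (leqP k j) => [kj|jk]; first by rewrite natrB.
by rewrite ffact_small // !mul0r.
Qed.

(** The linear system is triangular with ones on the diagonal. *)
Lemma binomial_transform_inj (a b : nat -> rat) :
  (forall j, \sum_(k < j.+1) 'C(j, k)%:R * a k = \sum_(k < j.+1) 'C(j, k)%:R * b k) ->
  a =1 b.
Proof.
move=> ab; elim/ltn_ind => j IHj; have := ab j.
rewrite !big_ord_recr /= binn !mul1r.
rewrite (eq_bigr (fun k : 'I_j => 'C(j, k)%:R * b k)) => [|k _]; last by rewrite IHj.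
exact: addrI.
Qed.

Lemma fact_rat_neq0 i : i`!%:R != 0 :> rat.
Proof. by rewrite pnatr_eq0 -lt0n fact_gt0. Qed.

(** As sequences in k, both sides have binomial transform j^n / n!: on the right by expanding e^(jt)
    = (1 + (e^t - 1))^j, on the left by evaluating the expansion of x^n at x = j. *)
Lemma stirling2_bar_coef N n k : (n < N)%N ->
  stirling2_bar n k = (('X * expm1X N : {poly rat}) ^+ k)`_n.
Proof.
move=> nN; have N0 : (0 < N)%N := leq_ltn_trans (leq0n n) nN.
have factN i : (i < N)%N -> i`!%:R != 0 :> rat by rewrite fact_rat_neq0.
apply: (binomial_transform_inj (fun k => stirling2_bar n k)
          (fun k => (('X * expm1X N) ^+ k)`_n)) => j /=.
transitivity (j%:R ^+ n / n`!%:R : rat); last first.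
  have := expX_exp _ _ factN 1 j N0 n nN.
  rewrite coef_poly nN mulr1 => <-; rewrite expX1E // exprDn coef_sum.
  by apply: eq_bigr => i _; rewrite expr1n mul1r coefMn mulr_natl.
(* A sum of this length can be split at j + 1; the falling factorials beyond vanish at j. *)
have := @stirling2P n (j.+1 + n.+1) (leq_addl _ _).
move=> /(congr1 (fun P : {poly rat} => P.[j%:R])); rewrite hornerXn => ->.
rewrite horner_sum big_split_ord /= [X in _ + X]big1 => [|i _]; last first.
  by rewrite hornerZ horner_falling_nat ffact_small ?mulr0 // leq_addr.
rewrite addr0 mulr_suml; apply: eq_bigr => i _.
rewrite hornerZ horner_falling_nat -bin_ffact natrM /stirling2_bar; ring.
Qed.

Lemma stirling2_barE N n k : (n + k < N)%N ->
  stirling2_bar (n + k) k = ((expm1X N : {poly rat}) ^+ k)`_n.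
Proof.
move=> nN; rewrite (stirling2_bar_coef N) // exprMn coefXnM.
by rewrite ltnNge leq_addl addnK.
Qed.

(** * Bernoulli series reduced modulo p *)

Section BernoulliModp.
Variable p : nat.
Hypothesis p_pr : prime p.
Let factN := fact_Fp_neq0 p p_pr.
Variable z : int.

Local Notation g := (expm1X p : {poly 'F_p}).

(** Coefficients are evaluated at the integer z before reduction. The bound is p - 1 because (e^t -
    1)/t has the coefficient 1/p! there. *)
Definition redser (a : nat -> {poly rat}) (P : {poly 'F_p}) :=
  forall i, (i < p.-1)%N -> red p (a i).[z%:~R] P`_i.

Lemma redser_mul a b P Q : redser a P -> redser b Q -> redser (ser_mul a b) (P * Q).
Proof.
move=> aP bQ i ip; rewrite coefM /ser_mul horner_sum; apply: red_sum => // j _.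
rewrite hornerM; apply: redM => //; [apply: aP|apply: bQ];
  by rewrite (leq_ltn_trans _ ip) // ?leq_subr // -ltnS.
Qed.

Lemma redser_pow a P k : redser a P -> redser (ser_pow a k) (P ^+ k).
Proof.
move=> aP; elim: k => [|k IHk]; last by rewrite exprS; apply: redser_mul.
by move=> i _; rewrite coef1 /= /ser1 -polyC_natr hornerC; apply: red_nat.
Qed.

(** With constant term 1, both inverses satisfy the same division-free recursion. *)
Lemma redser_inv a (P Q : {poly 'F_p}) : a 0%N = 1 -> P`_0 = 1 -> eqX p.-1 (P * Q) 1 ->
  redser a P -> redser (ser_inv a) Q.
Proof.
move=> a0 P0 PQ aP; elim/ltn_ind => i IHi ip.
have ua : a 0%N \is a GRing.unit by rewrite a0 unitr1.
have := PQ i ip; have := ser_mulV ua i.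
rewrite coefM coef1 /ser_mul !big_ord_recl a0 P0 !mul1r subn0.
move=> /(canRL (addrK _)) -> /(canRL (addrK _)) ->.
rewrite hornerD hornerN horner_sum /ser1 -polyC_natr hornerC.
apply: redD => //; first exact: red_nat.
apply: redN => //; apply: red_sum => // j _; rewrite hornerM lift0.
by apply: redM => //; [apply: aP|apply: IHi]; have := ltn_ord j; lia.
Qed.

Lemma horner_divn (P : {poly rat}) k y : (P / k`!%:R).[y] = P.[y] / k`!%:R.
Proof. by rewrite -[k`!%:R in LHS]polyC_natr polyCV hornerM hornerC. Qed.

Lemma redser_divX_expm1 : redser (ser_divX expm1) g.
Proof.
move=> i ip; rewrite /ser_divX /expm1 /ser_exp /ser1 /= subr0 horner_divn.
rewrite expr1n hornerC mul1r coef_poly ip; apply: red_invn; apply: factN.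
by rewrite -ltn_predRL.
Qed.

Lemma redser_exp : redser (ser_exp 'X) (expX p z%:~R).
Proof.
move=> i ip; have i_p : (i < p)%N := leq_trans ip (leq_pred p).
rewrite /ser_exp horner_divn hornerXn coef_poly i_p; apply: redM => //.
  by apply: redX => //; apply: red_int.
by apply: red_invn; apply: factN.
Qed.

Lemma ser_pow0 a m : a 0%N = 1 -> @ser_pow {poly rat} a m 0%N = 1.
Proof. by move=> a0; elim: m => //= m IHm; rewrite /ser_mul big_ord1 a0 IHm mul1r. Qed.

(** Since g^(m+M) = 1 modulo X^(p-1), the inverse of g^m reduces to the power g^M. *)
Lemma bernoulli_series_red m M : (m + M = 0 %[mod p])%N ->
  redser (bernoulli_series m) (expX p z%:~R * g ^+ M).
Proof.
move=> mM; rewrite mulrC; apply: redser_mul; last exact: redser_exp.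
apply: (redser_inv _ (g ^+ m)).
- by apply: ser_pow0; rewrite /ser_divX /expm1 /ser_exp /ser1 subr0 expr1 divr1.
- by rewrite coef0_exp coef_poly ltn_predRL prime_gt1 // invr1 expr1n.
- by rewrite -exprD; apply: (expm1X_congr p p_pr _ 0).
- by apply: redser_pow; apply: redser_divX_expm1.
Qed.

Lemma bernoulli_polyE m k : (bernoulli_poly m k).[z%:~R]
  = k`!%:R * (bernoulli_series m k).[z%:~R].
Proof. by rewrite /bernoulli_poly -polyC_natr hornerM hornerC. Qed.

End BernoulliModp.

(** * The substitution of - t for t *)

Section Reflection.
Variable p : nat.
Hypothesis p_pr : prime p.
Let p_gt0 : (0 < p)%N := prime_gt0 p_pr.
Let factN := fact_Fp_neq0 p p_pr.

Local Notation g := (expm1X p : {poly 'F_p}).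

Lemma coef_comp_NX (R : comNzRingType) (P : {poly R}) k :
  (P \Po - 'X)`_k = (-1) ^+ k * P`_k.
Proof.
rewrite coef_comp_poly.
have coefNX i : ((- 'X) ^+ i : {poly R})`_k = if k == i then (-1) ^+ k else 0.
  rewrite -scaleN1r exprZn coefZ coefXn.
  by case: eqP => [->|_]; rewrite ?mulr1 ?mulr0.
under eq_bigr => i _ do rewrite coefNX.
case: (ltnP k (size P)) => kP; last first.
  rewrite [P`_k]nth_default // mulr0 big1 // => i _.
  by rewrite gtn_eqF ?mulr0 // (leq_trans (ltn_ord i)).
rewrite (bigD1 (Ordinal kP)) //= eqxx mulrC big1 ?addr0 // => i ik.
by rewrite ifN ?mulr0 // eq_sym; apply: ik.
Qed.

Lemma expX_comp_NX (a : 'F_p) : expX p a \Po - 'X = expX p (- a).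
Proof.
apply/polyP => k; rewrite coef_comp_NX !coef_poly; case: ifP => _; last by rewrite mulr0.
by rewrite mulrA -exprMn mulN1r.
Qed.

(** Multiplied by X, both sides become 1 - e^(-t). *)
Lemma expm1X_comp_NX : eqX p.-1 (g \Po - 'X) (expX p (-1) * g).
Proof.
apply: eqX_mulX; rewrite prednK //.
have -> : 'X * (g \Po - 'X) = 1 - expX p (-1).
  have /(congr1 (fun P => P \Po - 'X)) := expX1E 'F_p p p_gt0.
  rewrite expX_comp_NX rmorphD rmorph1 rmorphM /= comp_polyX => ->; ring.
have -> : 'X * (expX p (-1) * g) = expX p (-1) * expX p 1 - expX p (-1).
  by rewrite [expX p 1]expX1E //; ring.
move=> i ip; rewrite !coefB; congr (_ - _).
by rewrite (expXD _ _ factN) // addNr expX0.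
Qed.

(* t |-> - t turns g into e^(-t) g. *)
Lemma expm1X_reflection (a : 'F_p) k : (k < p.-1)%N ->
  (expX p (- a) * g ^+ p.-1)`_k = (-1) ^+ k * (expX p (a + 1) * g ^+ p.-1)`_k.
Proof.
move=> kp; rewrite -coef_comp_NX rmorphM rmorphXn /= expX_comp_NX.
apply: (eqX_sym _ p.-1) (kp).
apply: eqX_trans (eqX_mul _ _ _ _ _ _ (eqX_refl _ _ _) (eqX_exp _ _ _ _ p.-1 expm1X_comp_NX)) _.
rewrite exprMn mulrA; apply: eqX_mul => //.
apply: (@eqX_le _ _ p); first exact: leq_pred.
apply: eqX_trans (eqX_mul _ _ _ _ _ _ (eqX_refl _ _ _) (expX_exp _ _ factN _ p.-1 p_gt0)) _.
have <- : - (a + 1) + p.-1%:R * -1 = - a :> 'F_p; last exact: expXD.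
have : p.-1%:R + 1 = 0 :> 'F_p by rewrite natr1 prednK // pchar_Fp_0.
by move=> /(canRL (addrK _)) ->; ring.
Qed.

End Reflection.

(** * Reduction of each side of the congruences *)

Section MainCongruences.
Variable p : nat.
Hypothesis p_pr : prime p.
Let p_gt0 : (0 < p)%N := prime_gt0 p_pr.

Local Notation g := (expm1X p : {poly 'F_p}).
Local Notation star n := (residue (- n%:Z) p.-1).

Lemma star_lt n : (star n < p.-1)%N.
Proof.
have := prime_gt1 p_pr => p1.
have := @ltz_pmod (- n%:Z) p.-1%:Z; have := @modz_ge0 (- n%:Z) p.-1%:Z.
rewrite /residue; lia.
Qed.

Lemma fleck_quotient_red n (r : int) : (0 < n)%N ->
  red p ((-1) ^+ n * fleck_quotient p n r) (expX p (- r%:~R) * g ^+ n)`_(star n).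
Proof.
move=> n0; have [k -> <-] := fleck_quotient_Fp p p_pr n r n0.
by apply: redM; [apply: redX; apply: (red_int p (-1)) | apply: red_int].
Qed.

Lemma fleck_quotient0_red n :
  red p ((-1) ^+ n * fleck_quotient p n 0) (g ^+ n)`_(star n).
Proof.
case: n => [|n]; last first.
  by have := fleck_quotient_red n.+1 0 isT; rewrite oppr0 expX0 // mul1r.
have -> : star 0%N = 0%N by rewrite /residue oppr0 mod0z.
rewrite expr0 mul1r coef1 /fleck_quotient /fleck_sum big_mkcond big_ord1 /= bin0 mulr1.
have p1 := prime_gt1 p_pr.
(* For n = 0 the floor of -1/(p - 1) is -1, so the quotient is 1 - p. *)
have -> : (0%N%:Z - 1 = (-1) * (p%:Z - 1) + (p%:Z - 2))%R by lia.
rewrite divzMDl; last by lia.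
rewrite divz_small; last by lia.
rewrite addr0 opprK expr1z eqxx mulr1.
have -> : 1 = - p%:R + 1 :> 'F_p by rewrite pchar_Fp_0 // oppr0 add0r.
by apply: redD => //; [apply: redN => //; apply: red_nat | apply: (red_nat p 1)].
Qed.

Lemma bernoulli_poly_red m M n (z : int) : (m + M = 0 %[mod p])%N ->
  red p ((bernoulli_poly m (star n)).[z%:~R] / (star n)`!%:R)
        (expX p z%:~R * g ^+ M)`_(star n).
Proof.
move=> mM; rewrite bernoulli_polyE mulrAC divff ?fact_rat_neq0 // mul1r.
by apply: bernoulli_series_red => //; apply: star_lt.
Qed.

Lemma star_widen n : star (p * n + p - 1)%N = star n.
Proof.
rewrite /residue; have -> : - (p * n + p - 1)%N%:Z = (- n.+1%:Z) * p.-1%:Z + (- n%:Z) by nia.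
by rewrite modzMDl.
Qed.

Lemma bernoulli_reflection_red n (r : int) :
  red p (- ((p - 1 - star n)`!%:R * (bernoulli_poly 1 (star n)).[(r + 1)%:~R]))
        (expX p (- r)%:~R * g ^+ p.-1)`_(star n).
Proof.
have ltp := star_lt n; have ltp' := leq_trans ltp (leq_pred p).
have nz := fact_Fp_neq0 p p_pr _ ltp'.
rewrite bernoulli_polyE rmorphN expm1X_reflection //.
have <- : (r + 1)%:~R = r%:~R + 1 :> 'F_p by rewrite rmorphD.
set c := (X in _ ^+ star n * X).
(* The sign from the reflection is absorbed by the product of complementary factorials. *)
have -> : (-1) ^+ star n * c = - ((p - 1 - star n)`!%:R * ((star n)`!%:R * c)).
  rewrite mulrA subn1 [X in X * c]mulrC fact_Fp_compl // exprS; ring.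
apply: redN => //; apply: redM => //; first exact: red_nat.
apply: redM => //; first exact: red_nat.
apply: (bernoulli_series_red p p_pr (r + 1)) => //.
by rewrite add1n prednK // modnn mod0n.
Qed.

End MainCongruences.

(** * Fleck quotients at p n + p - 1, and the binomial case n = 1 *)

Section ShiftedArgument.
Variable p : nat.
Hypothesis p_pr : prime p.
Let p_gt0 : (0 < p)%N := prime_gt0 p_pr.
Let p_gt1 : (1 < p)%N := prime_gt1 p_pr.

Lemma fleck_quotient_widen_red n (r : int) :
  red p ((-1) ^+ n * fleck_quotient p (p * n + p - 1) r)
        (expX p (- r)%:~R * expm1X p ^+ p.-1)`_(residue (- n%:Z) p.-1).
Proof.
pose m := (p * n + p - 1)%N.
have H : red p ((-1) ^+ m * fleck_quotient p m r)
           (expX p (- r%:~R) * expm1X p ^+ m)`_(residue (- n%:Z) p.-1).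
  by rewrite -(star_widen p p_pr); apply: fleck_quotient_red => //; rewrite /m; lia.
(* The sign (-1)^(n+m) may be -1 over Q when p = 2, but it always reduces to 1 in F_p. *)
have -> : (-1) ^+ n * fleck_quotient p m r
    = (-1) ^+ (n + m) * ((-1) ^+ m * fleck_quotient p m r).
  by rewrite exprD mulrA -[X in _ = X * _]mulrA -exprMn mulrNN mulr1 expr1n mulr1.
rewrite rmorphN; set c := (X in red _ _ X).
have -> : c = (-1) ^+ (n + m) * (expX p (- r%:~R) * expm1X p ^+ m)`_(residue (- n%:Z) p.-1).
  have -> : (-1) ^+ (n + m) = 1 :> 'F_p.
    have -> : (n + m = p * n + (n + p.-1))%N by rewrite /m; lia.
    rewrite !exprD exprM sign_Fp_p // expf_p1 ?oppr_eq0 ?oner_eq0 // mulr1.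
    by rewrite -exprMn mulrNN mulr1 expr1n.
  rewrite mul1r /c; apply: (eqX_mul _ p.-1); last exact: star_lt.
    by [].
  apply: expm1X_congr => //; have -> : m = (n * p + p.-1)%N by rewrite /m; lia.
  by rewrite modnMDl.
by apply: redM => //; apply: redX; apply: (red_int p (-1)).
Qed.

(** Among the indices 0..2p-1 only r and p + r lie in the class of r. *)
Lemma fleck_sum_double (r : nat) : (r < p)%N ->
  fleck_sum p (2 * p - 1) r%:Z
  = (-1) ^+ r * ('C(2 * p - 1, r)%:Z + (-1) ^+ p * 'C(2 * p - 1, p + r)%:Z).
Proof.
move=> rp; rewrite /fleck_sum; have -> : (2 * p - 1).+1 = (p + p)%N by lia.
rewrite big_split_ord /= !(big_pred1 (Ordinal rp)) /=; first by rewrite exprD; ring.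
  by move=> i /=; rewrite PoszD modzDl !modz_nat !modn_small.
by move=> i /=; rewrite !modz_nat !modn_small.
Qed.

Lemma fleck_quotient_double (r : nat) : (r < p)%N ->
  'C(2 * p - 1, p + r)%:R + (-1) ^+ p * 'C(2 * p - 1, r)%:R
  = p%:R ^+ 2 * ((-1) ^+ (p + r) * fleck_quotient p (2 * p - 1) r%:Z) :> rat.
Proof.
move=> rp; rewrite /fleck_quotient gtn_eqF ?addr0; last by lia.
have -> : ((2 * p - 1)%N%:Z - 1 = 2%:Z * (p%:Z - 1))%R by lia.
rewrite mulzK; last by lia.
have p0 : p%:~R != 0 :> rat by rewrite -pmulrn pnatr_eq0; lia.
rewrite fleck_sum_double // -exprnN sqrrN.
rewrite rmorphM rmorphD rmorphM !rmorphXn rmorphN1 /= !pmulrn exprD.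
have s2 k : ((-1) ^+ k : rat) * (-1) ^+ k = 1 by rewrite -exprMn mulrNN mulr1 expr1n.
set a := (-1) ^+ p; set b := (-1) ^+ r; set x := _%:~R; set y := _%:~R.
transitivity (a * a * (b * b) * y + a * (b * b) * x); first by rewrite !s2 !mulr1 !mul1r.
by field.
Qed.

End ShiftedArgument.

Theorem corollary1p4 (p : nat) (p_prime : prime p) (n : nat) :
  let nstar := residue (- n%:Z) p.-1 in
  let n0 := residue n%:Z p in
  (eqmod_padic p 1 ((-1) ^+ n * fleck_quotient p n 0)
                   (stirling2_bar (nstar + n0) n0)
   /\ forall m : nat, (m + n = 0 %[mod p])%N ->
      eqmod_padic p 1 (stirling2_bar (nstar + n0) n0)
                      (bernoulli_number m nstar / nstar`!%:R))
  /\ (forall r : int,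
      eqmod_padic p 1 ((-1) ^+ n * fleck_quotient p (p * n + p - 1) r)
                      ((bernoulli_poly 1 nstar).[(- r)%:~R] / nstar`!%:R)
      /\ eqmod_padic p 1
           ((bernoulli_poly 1 nstar).[(- r)%:~R] / nstar`!%:R)
           (- ((p - 1 - nstar)%N`!%:R * (bernoulli_poly 1 nstar).[(r + 1)%:~R])))
  /\ (forall r : nat, (r < p)%N ->
      eqmod_padic p 3
        ('C(2 * p - 1, p + r)%:R + (-1) ^+ p * 'C(2 * p - 1, r)%:R)
        ((-1) ^+ r * p%:R ^+ 2 * (bernoulli_poly 1 (p - 2)).[- r%:R])).
Proof.
have p_gt0 := prime_gt0 p_prime; have p_gt1 := prime_gt1 p_prime.
have B k (r : int) (kstar := residue (- k%:Z) p.-1) :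
    red p ((bernoulli_poly 1 kstar).[(- r)%:~R] / kstar`!%:R)
      (expX p (- r)%:~R * expm1X p ^+ p.-1)`_kstar.
  by apply: bernoulli_poly_red => //; rewrite add1n prednK // modnn mod0n.
move=> nstar n0; split; [|split].
- have S : red p (stirling2_bar (nstar + n0) n0) (expm1X p ^+ n)`_nstar.
    have <- : (expm1X p ^+ n0 : {poly 'F_p})`_nstar = (expm1X p ^+ n)`_nstar.
      apply: (expm1X_congr p p_prime); last exact: star_lt.
      by rewrite /n0 /residue modz_nat absz_nat modn_mod.
    (* Large enough for the Stirling coefficient over Q and for reduction to the truncation at p. *)
    pose N := (nstar + n0 + p).+1.
    rewrite (stirling2_barE N) ?ltnS ?leq_addr //.
    apply: redpolyX; last exact: star_lt.
    by apply: redpoly_expm1X => //; apply: leqW (leq_addl _ _).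
  split=> [|m mn].
    exact: red_eqmod p p_prime _ _ _ (fleck_quotient0_red p p_prime n) S.
  apply: (red_eqmod p p_prime _ _ _ S).
  have := bernoulli_poly_red p p_prime m n n 0.
  by rewrite expX0 // mul1r; apply; rewrite mn.
- move=> r; split; first exact: red_eqmod (fleck_quotient_widen_red p p_prime n r) (B n r).
  exact: red_eqmod (B n r) (bernoulli_reflection_red p p_prime n r).
(* This is the case n = 1 of the previous congruence: a congruence modulo p is multiplied by p^2. *)
- move=> r rp; rewrite fleck_quotient_double //.
  have star1 : residue (- 1%:Z) p.-1 = (p - 2)%N.
    by rewrite (residueN p p_prime 1 1 0) ?muln0 //; lia.
  have F1 := fleck_quotient_widen_red p p_prime 1 r.
  have := B 1%N r; move: F1; rewrite star1.
  have -> : (p * 1 + p - 1 = 2 * p - 1)%N by lia.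
  set c := (X in red _ _ X); set F := fleck_quotient _ _ _.
  rewrite expr1 rmorphN /= -pmulrn; set b := _.[_] => Fc Bc.
  (* The complement of p - 2 is 1, so the factorial equals (-1)^(p-1) = 1; this removes the
     denominator. *)
  have fact1 : (p - 2)`!%:R = 1 :> 'F_p.
    have := fact_Fp_compl p p_prime (p - 2).
    have -> : (p.-1 - (p - 2) = 1)%N by lia.
    have -> : ((p - 2).+1 = p.-1)%N by lia.
    by rewrite mulr1 expf_p1 ?oppr_eq0 ?oner_eq0 //; apply; lia.
  have [z zint E] : eqmod_padic p 1 ((-1) ^+ (p + r) * F) ((-1) ^+ r * b).
    apply: (red_eqmod p p_prime _ _ ((-1) ^+ r * c)).
      (* The signs agree only after reduction, where (-1)^p = -1 for every p. *)
      have -> : (-1) ^+ (p + r) * F = (-1) ^+ (p + r).+1 * (-1 * F) by rewrite exprS; ring.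
      apply: redM => //; rewrite -addnS exprD exprS.
      have -> : (-1) ^+ r = (-1) ^+ p * (-1 * (-1) ^+ r) :> 'F_p.
        by rewrite sign_Fp_p //; ring.
      by apply: redM; [|apply: redM]; try apply: redX; apply: (red_int p (-1)).
    apply: redM; first by apply: redX; apply: (red_int p (-1)).
    have -> : c = (p - 2)`!%:R * c by rewrite fact1 mul1r.
    have -> : b = (p - 2)`!%:R * (b / (p - 2)`!%:R).
      by rewrite mulrCA divff ?mulr1 // fact_rat_neq0.
    by apply: redM => //; apply: red_nat.
  exists z => //; rewrite [(-1) ^+ r * _]mulrC -[p%:R ^+ 2 * (-1) ^+ r * _]mulrA -mulrBr E.
  by rewrite mulrA -exprSr.
Qed.
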